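(* Let $X=c_0(\mathbb{Z})$ over $\mathbb{K}\in\{\mathbb{R},\mathbb{C}\}$, let $w=(w(n))_{n\in\mathbb{Z}}$ be a bounded sequence of weights in $\mathbb{K}$ with $\inf_{n\in\mathbb{Z}}|w(n)|>0$, and let $B_w$ be the bilateral weighted backward shift on $X$ given by $w$. If $B_w$ has nontrivial (i.e. nonzero) periodic points, then the periodic shadowing property of $B_w$ is equivalent to the shadowing property of $B_w$. If not, then the periodic shadowing property of $B_w$ is equivalent to the following condition: for every $\varepsilon>0$ there is $\delta>0$ such that for all integers $k\le l\le m$ one of the following holds: $$(a)\quad \left|\frac{\varepsilon}{w(l+1)\cdots w(m)}-\delta\sum_{i=0}^{m-(l+1)}\frac{1}{w(m)\cdots w(m-i)}\right|\ge\delta,$$ $$(b)\quad \left|w(k)\cdots w(l)\,\varepsilon-\delta\sum_{i=0}^{(l-1)-k}w(k)\cdots w(k+i)\right|\ge\delta.$$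
   Context: $B_w((x_n)_{n\in\mathbb{Z}})=(w(n+1)x_{n+1})_{n\in\mathbb{Z}}$; under the assumptions on $w$ it is a bounded invertible operator on $X$. Empty products equal $1$ and empty sums equal $0$ (relevant when $m=l$ in (a) and $k=l$ in (b)). Let $T$ be an invertible bounded operator on a normed space $X$. A $\delta$-pseudotrajectory of $T$ is a sequence $(x_j)$ indexed by an interval of integers (at least two elements) with $\|Tx_j-x_{j+1}\|<\delta$ for all consecutive indices. A $\delta$-pseudotrajectory $(x_j)_{j\in\mathbb{Z}}$ is periodic if there is $p\in\mathbb{N}$ with $x_{j+p}=x_j$ for all $j\in\mathbb{Z}$. A point $x$ is periodic for $T$ if $T^px=x$ for some $p\in\mathbb{N}$. $T$ has the shadowing property if for every $\varepsilon>0$ there is $\delta>0$ such that for every $\delta$-pseudotrajectory $(x_j)_{j\in\mathbb{Z}}$ there is $x\in X$ with $\|x_j-T^jx\|<\varepsilon$ for all $j\in\mathbb{Z}$. $T$ has the periodic shadowing property if for every $\varepsilon>0$ there is $\delta>0$ such that for every periodic $\delta$-pseudotrajectory $(x_j)_{j\in\mathbb{Z}}$ there is a periodic point $x$ of $T$ with $\|x_j-T^jx\|<\varepsilon$ for all $j\in\mathbb{Z}$.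
   Formalization: In conditions (a) and (b) the weights w(n) are replaced by their moduli |w(n)|; as written the second equivalence fails for w(n) = -1 for all n, where the condition holds but periodic shadowing does not. For positive weights nothing changes. *)

(* Defs.v *)
From HB Require Import structures.
From mathcomp Require Import all_boot all_order all_algebra.
From mathcomp Require Import boolp classical_sets functions reals.
From mathcomp Require Import topology normedtype sequences.
From mathcomp Require Import complex.

Set Implicit Arguments.
Unset Strict Implicit.
Unset Printing Implicit Defensive.

Import Order.TTheory GRing.Theory Num.Theory.
Import numFieldNormedType.Exports.

Local Open Scope classical_set_scope.
Local Open Scope ring_scope.

(* Everything is developed over an arbitrary [numFieldType], so that it applies
   to both R and R[i]; norms, and the numbers epsilon and delta, live in K, where
   [0 < e] entails that e is real. *)

Section C0.
Variable K : numFieldType.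

Definition c0_seq : {pred (int -> K)} := fun x =>
  `[< (fun n : nat => x n%:Z) @ \oo --> (0 : K) /\
      (fun n : nat => x (- n%:Z)) @ \oo --> (0 : K) >].

Lemma c0_seqP (x : int -> K) : reflect
  (forall e : K, 0 < e -> exists N : nat, forall n : int,
     (N <= `|n|)%N -> `|x n| < e)
  (x \in c0_seq).
Proof.
apply: (iffP (asboolP _)) => [[xp xn] e e0|H].
  move/cvgr0_norm_lt : xp => /(_ e e0) [N1 _ h1].
  move/cvgr0_norm_lt : xn => /(_ e e0) [N2 _ h2].
  exists (maxn N1 N2) => n; rewrite geq_max => /andP[n1 n2].
  have := leP 0 n; case=> [n0|/ltW n0].
    by have := h1 _ n1; rewrite /= gez0_abs.
  by have := h2 _ n2; rewrite /= lez0_abs// opprK.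
split; apply/cvgr0Pnorm_lt => e e0; have [N hN] := H e e0;
  exists N => // n /= Nn; apply: hN => //.
by rewrite abszN.
Qed.

Fact c0_submod_closed : submod_closed c0_seq.
Proof.
split=> [|a x y /c0_seqP hx /c0_seqP hy].
  by apply/c0_seqP => e e0; exists 0%N => n _; rewrite normr0.
apply/c0_seqP => e e0.
have a1 : 0 < `|a| + 1 by rewrite ltr_wpDl.
have d0 : 0 < e / 2 / (`|a| + 1) by rewrite !divr_gt0.
have e2 : 0 < e / 2 by rewrite divr_gt0.
have [N1 h1] := hx _ d0; have [N2 h2] := hy _ e2.
exists (maxn N1 N2) => n; rewrite geq_max => /andP[/h1 n1 /h2 n2].
rewrite (splitr e); apply: (le_lt_trans (ler_normD _ _)).
apply: ler_ltD => //; rewrite normrM.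
apply: (@le_trans _ _ ((`|a| + 1) * `|x n|)).
  by rewrite ler_wpM2r// lerDl.
by rewrite mulrC -ler_pdivlMr// ltW.
Qed.

HB.instance Definition _ :=
  GRing.isSubmodClosed.Build K (int -> K) c0_seq c0_submod_closed.

Record c0 := C0 { c0_val :> int -> K; _ : c0_val \in c0_seq }.

HB.instance Definition _ := [isSub for c0_val].
HB.instance Definition _ := [Choice of c0 by <:].
HB.instance Definition _ := [SubChoice_isSubLmodule of c0 by <:].

Lemma c0_ext (x y : c0) : (forall n, x n = y n) -> x = y.
Proof. by move=> xy; apply/val_inj/funext. Qed.

(* In the partially ordered field R[i] this is a supremum for the order of the
   nonnegative reals; see [c0_normE] for its existence (it is attained). *)
Definition c0_norm (x : c0) : K := supremum 0 [set `|x n| | n in setT].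

Lemma c0_max (x : c0) : exists m, forall n, `|x n| <= `|x m|.
Proof.
have cmp a b : `|a : K| <= `|b : K| \/ `|b| <= `|a|.
  by apply/orP; apply: real_leVge; exact: normr_real.
have fin N : exists m, forall n : int, (`|n| < N)%N -> `|x n| <= `|x m|.
  elim: N => [|N [m hm]]; first by exists 0.
  have [m' h1 h2] : exists2 m',
      `|x m| <= `|x m'| & `|x N%:Z| <= `|x m'|.
    by case: (cmp (x m) (x N%:Z)) => ?; [exists N%:Z|exists m].
  have [m'' h3 h4] : exists2 m'',
      `|x m'| <= `|x m''| & `|x (- N%:Z)| <= `|x m''|.
    by case: (cmp (x m') (x (- N%:Z))) => ?; [exists (- N%:Z)|exists m'].
  exists m'' => n; rewrite ltnS leq_eqVlt => /orP[/eqP nN|/hm h].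
    case: (leP 0 n) => [n0|/ltW n0].
      by rewrite -(gez0_abs n0) nN (le_trans h2).
    by rewrite -(opprK n) -(lez0_abs n0) nN.
  by rewrite (le_trans h)// (le_trans h1).
have [[p p0]|x0] := pselect (exists p, x p != 0); last first.
  exists 0 => n; suff -> : x n = 0 by rewrite normr0.
  by apply/eqP/negPn/negP => xn0; apply: x0; exists n.
have /c0_seqP/(_ `|x p|) := valP x; rewrite normr_gt0 => /(_ p0) [N hN].
have [m hm] := fin N; exists m => n.
case: (ltnP `|n|%N N) => [/hm //|/hN/ltW/le_trans]; apply; apply: hm.
by rewrite ltnNge; apply/negP => /hN; rewrite ltxx.
Qed.

Lemma c0_normE (x : c0) : exists2 m, c0_norm x = `|x m| &
  forall n, `|x n| <= `|x m|.
Proof.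
have [m hm] := c0_max x; exists m => //.
rewrite /c0_norm /supremum ifF; last first.
  by apply/eqP => /seteqP[/(_ `|x m|) + _]; apply; exists m.
have hs : supremums [set `|x n| | n in setT] `|x m|.
  by split=> [_ [n _ <-]|y /(_ `|x m|)]; [exact: hm|apply; exists m].
exact/(is_subset1_supremums _ hs)/(xgetPex _ (ex_intro _ _ hs)).
Qed.

Lemma le_c0_norm (x : c0) n : `|x n| <= c0_norm x.
Proof. by have [m -> ] := c0_normE x. Qed.

Lemma c0_norm_le (x : c0) M : (forall n, `|x n| <= M) -> c0_norm x <= M.
Proof. by have [m -> _] := c0_normE x; exact. Qed.

Fact c0_ler_normD (x y : c0) : c0_norm (x + y) <= c0_norm x + c0_norm y.
Proof.
apply: c0_norm_le => n; apply: (le_trans (ler_normD _ _)).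
by rewrite lerD ?le_c0_norm.
Qed.

Fact c0_normrZ (a : K) (x : c0) : c0_norm (a *: x) = `|a| * c0_norm x.
Proof.
apply/eqP; rewrite eq_le; apply/andP; split.
  by apply: c0_norm_le => n; rewrite normrM ler_wpM2l// le_c0_norm.
have [m -> _] := c0_normE x.
by apply: le_trans (le_c0_norm _ m); rewrite normrM.
Qed.

Fact c0_normr0_eq0 (x : c0) : c0_norm x = 0 -> x = 0.
Proof.
move=> x0; apply: c0_ext => n; apply/eqP.
by rewrite -normr_le0 -x0 le_c0_norm.
Qed.

HB.instance Definition _ :=
  Lmodule_isNormed.Build K c0 c0_ler_normD c0_normrZ c0_normr0_eq0.

Lemma c0_normrE (x : c0) : `|x| = supremum 0 [set `|x n| | n in setT].
Proof. by []. Qed.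

End C0.

Section Shadowing.
Variables (K : numFieldType) (X : normedModType K).

Record invertible_operator := InvertibleOperator {
  op :> {linear X -> X};
  op_inv : {linear X -> X};
  op_bounded : bounded_near op (nbhs 0);
  op_inv_bounded : bounded_near op_inv (nbhs 0);
  opK : cancel op op_inv;
  op_invK : cancel op_inv op
}.

Variable T : invertible_operator.

Definition op_exp (j : int) : X -> X :=
  match j with
  | Posz n => iter n T
  | Negz n => iter n.+1 (op_inv T)
  end.

Definition pseudotrajectory (delta : K) (x : int -> X) :=
  forall j : int, `|T (x j) - x (j + 1)| < delta.

Definition periodic_sequence (x : int -> X) :=
  exists2 p : nat, (0 < p)%N & forall j : int, x (j + p%:Z) = x j.

Definition periodic_point (x : X) :=
  exists2 p : nat, (0 < p)%N & iter p T x = x.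

Definition shadowing_property :=
  forall eps : K, 0 < eps -> exists2 delta : K, 0 < delta &
    forall x : int -> X, pseudotrajectory delta x ->
    exists y : X, forall j : int, `|x j - op_exp j y| < eps.

Definition periodic_shadowing_property :=
  forall eps : K, 0 < eps -> exists2 delta : K, 0 < delta &
    forall x : int -> X, pseudotrajectory delta x -> periodic_sequence x ->
    exists2 y : X, periodic_point y &
      forall j : int, `|x j - op_exp j y| < eps.

End Shadowing.

Section Shift.
Variables (K : numFieldType) (w : int -> K).
Hypothesis w_bounded : bounded_fun w.
Hypothesis w_inf : 0 < infimum 0 [set `|w n| | n in setT].

Let w_ub : exists2 C, 0 < C & forall n, `|w n| <= C.
Proof.
have [|C C0 h] := @ex_strict_bound_gt0 _ _ _ w (globally setT).
  exact: w_bounded.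
by exists C => // n; rewrite ltW// h.
Qed.

Let w_lb : exists2 c, 0 < c & forall n, c <= `|w n|.
Proof.
move: w_inf; rewrite /infimum; case: ifPn => [_|_]; first by rewrite ltxx.
case: xgetP => [c _ [lbc _] c0|_]; last by rewrite ltxx.
by exists c => // n; apply: lbc; exists n.
Qed.

Let w_neq0 n : w n != 0.
Proof.
by have [c c0 /(_ n) h] := w_lb; rewrite -normr_gt0 (lt_le_trans c0).
Qed.

Let wV_ub : exists2 C, 0 < C & forall n, `|(w n)^-1| <= C.
Proof.
have [c c0 h] := w_lb; exists c^-1; rewrite ?invr_gt0// => n.
by rewrite normfV lef_pV2// posrE ?normr_gt0.
Qed.

Let c0_dom (x : c0 K) (y : int -> K) (s : int) C : 0 < C ->
  (forall n, `|y n| <= C * `|x (n + s)|) -> y \in @c0_seq K.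
Proof.
move=> C0 h; apply/c0_seqP => e e0.
have /c0_seqP/(_ (e / C)) := valP x; rewrite divr_gt0// => /(_ isT) [N hN].
exists (N + `|s|)%N => n Nn; rewrite (le_lt_trans (h n))//.
rewrite mulrC -ltr_pdivlMr//; apply: hN.
have := leqD_dist n (- s) 0; rewrite !subr0 opprK abszN => Nn'.
by rewrite -(leq_add2r `|s|%N) (leq_trans Nn).
Qed.

Fact shift_subproof (x : c0 K) :
  (fun n => w (n + 1) * x (n + 1)) \in @c0_seq K.
Proof.
have [C C0 h] := w_ub.
by apply: (@c0_dom x _ 1 C) => // n; rewrite normrM ler_wpM2r.
Qed.

Definition shift_fun (x : c0 K) : c0 K := C0 (shift_subproof x).

Fact shift_inv_subproof (x : c0 K) :
  (fun n => (w n)^-1 * x (n - 1)) \in @c0_seq K.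
Proof.
have [C C0 h] := wV_ub.
by apply: (@c0_dom x _ (-1) C) => // n; rewrite normrM ler_wpM2r.
Qed.

Definition shift_inv_fun (x : c0 K) : c0 K := C0 (shift_inv_subproof x).

Fact shift_is_linear : linear shift_fun.
Proof.
move=> a x y; apply: c0_ext => n /=.
by rewrite mulrDr mulrCA.
Qed.

HB.instance Definition _ :=
  GRing.isLinear.Build K (c0 K) (c0 K) *:%R shift_fun shift_is_linear.

Fact shift_inv_is_linear : linear shift_inv_fun.
Proof.
move=> a x y; apply: c0_ext => n /=.
by rewrite mulrDr mulrCA.
Qed.

HB.instance Definition _ :=
  GRing.isLinear.Build K (c0 K) (c0 K) *:%R shift_inv_fun shift_inv_is_linear.

Fact shift_bounded : bounded_near shift_fun (nbhs 0).
Proof.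
have [C C0 h] := w_ub; apply/linear_boundedP.
exists C; split; first exact: gtr0_real.
move=> r Cr x; apply: c0_norm_le => n; rewrite /= normrM.
by rewrite ler_pM// ?le_c0_norm// (le_trans (h _))// ltW.
Qed.

Fact shift_inv_bounded : bounded_near shift_inv_fun (nbhs 0).
Proof.
have [C C0 h] := wV_ub; apply/linear_boundedP.
exists C; split; first exact: gtr0_real.
move=> r Cr x; apply: c0_norm_le => n; rewrite /= normrM.
by rewrite ler_pM// ?le_c0_norm// (le_trans (h _))// ltW.
Qed.

Fact shiftK : cancel shift_fun shift_inv_fun.
Proof.
by move=> x; apply: c0_ext => n /=; rewrite subrK mulKf.
Qed.

Fact shift_invK : cancel shift_inv_fun shift_fun.
Proof.
by move=> x; apply: c0_ext => n /=; rewrite addrK mulVKf.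
Qed.

Definition weighted_shift : invertible_operator (c0 K) :=
  InvertibleOperator shift_bounded shift_inv_bounded shiftK shift_invK.

Lemma weighted_shiftE (x : c0 K) n :
  weighted_shift x n = w (n + 1) * x (n + 1).
Proof. by []. Qed.

End Shift.

Section Condition.
Variables (K : numFieldType) (w : int -> K).

(* [wprod a b] is w(a) ... w(b); it is empty when b < a. *)
Definition wprod (a b : int) : K :=
  \prod_(0 <= i < `|(Num.max 0 (b - a + 1))%R|%N) w (a + i%:Z).

(* For l <= m (resp. k <= l) the sum has m - l (resp. l - k) terms, none of them
   when m = l (resp. k = l). *)
Definition condition_a (eps delta : K) (l m : int) :=
  delta <= `| eps / wprod (l + 1) m
    - delta * \sum_(0 <= i < `|m - l|%N) (wprod (m - i%:Z) m)^-1 |.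

Definition condition_b (eps delta : K) (k l : int) :=
  delta <= `| wprod k l * eps
    - delta * \sum_(0 <= i < `|l - k|%N) wprod k (k + i%:Z) |.

(* To be applied to the moduli [`|w n|] of the weights of the shift: B_w is
   isometrically conjugate to B_|w|, whereas the condition on w itself depends on
   the arguments of the weights (it holds for w = -1 and fails for w = 1). *)
Definition weight_condition :=
  forall eps : K, 0 < eps -> exists2 delta : K, 0 < delta &
    forall k l m : int, k <= l -> l <= m ->
      condition_a eps delta l m \/ condition_b eps delta k l.

End Condition.

(* Main.v *)
(* Let u be the sequence with u 0 = 1 and B u = u (coordinatewise).  Writing
   elements of c0 as u * g turns B into the unweighted shift of g, and a
   pseudotrajectory splits into independent sequences g_s along the lines
   [j + n = s], with |u n| |g_s (n + 1) - g_s n| < delta; exact orbits are the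
   constant g_s.

   Nonzero periodic points exist iff u is in c0.  Shadowing then gives periodic
   shadowing by repeating p consecutive constants.  Conversely, periodic
   shadowing of constant pseudotrajectories, applied to truncations, bounds
   |u n| |g_s n - g_s 0|, so g_s 0 is a shadowing constant on each line; the
   same bound forces |u| to decay uniformly away from 0, which puts the resulting
   point [u n * g_n 0] in c0.

   Without periodic points the only possible shadow is 0, so a failure of
   periodic shadowing is a line sequence vanishing at both ends with
   |u l g l| >= eps.
   Descending from the index l as fast as delta allows reaches 0 on both sides
   exactly when (a) and (b) fail. *)
Require Import Defs.
From HB Require Import structures.
From mathcomp Require Import all_boot all_order all_algebra.
From mathcomp Require Import boolp classical_sets functions reals.
From mathcomp Require Import topology normedtype sequences.
From mathcomp Require Import complex.
From mathcomp Require Import zify ring.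

Import Order.TTheory GRing.Theory Num.Theory.
Import numFieldNormedType.Exports.

Local Open Scope classical_set_scope.
Local Open Scope ring_scope.

Lemma int_recursion (T : Type) (x0 : T) (s s' : int -> T -> T) :
  (forall n, cancel (s' n) (s n)) ->
  exists F : int -> T, F 0 = x0 /\ forall n, F (n + 1) = s n (F n).
Proof.
move=> sK.
pose P := fix P n := if n is n'.+1 then s n'%:Z (P n') else x0.
pose N := fix N n := if n is n'.+1 then s' (- n'.+1%:Z) (N n') else x0.
exists (fun n => match n with Posz k => P k | Negz k => N k.+1 end).
split=> // -[n|[|n]].
- by rewrite -PoszD addn1.
- by rewrite -[LHS]/x0 [RHS]sK.
- rewrite (_ : Negz n.+1 + 1 = Negz n); last by rewrite !NegzE; lia.
  by rewrite [RHS]sK.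
Qed.

Lemma int_succ_ind (P : int -> Prop) :
  P 0 -> (forall n, P n <-> P (n + 1)) -> forall n, P n.
Proof.
move=> P0 PS; elim/int_rect => // n; first by rewrite -addn1 PoszD => /PS.
move=> Pn; apply/PS.
by rewrite (_ : - n.+1%:Z + 1 = - n%:Z)//; lia.
Qed.

Lemma int_primitive (V : zmodType) (f : int -> V) :
  exists H : int -> V, forall n, H (n + 1) = H n + f n.
Proof.
have [|H [_ HS]] :=
  @int_recursion V 0 (fun n x => x + f n) (fun n x => x - f n).
  by move=> n x; rewrite subrK.
by exists H.
Qed.

Lemma periodic_modz (T : Type) (f : int -> T) (p : nat) :
  (forall j, f (j + p%:Z) = f j) -> forall j, f j = f (j %% p)%Z.
Proof.
move=> fp j; rewrite [in LHS](divz_eq j p) addrC.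
have fn (n : nat) i : f (i + n%:Z * p%:Z) = f i.
  elim: n i => [|n IHn] i; first by rewrite mul0r addr0.
  by rewrite -addn1 PoszD mulrDl mul1r addrA fp IHn.
case: (j %/ p)%Z => n; first exact: fn.
by rewrite NegzE -[LHS](fn n.+1) mulNr subrK.
Qed.

Section Order.
Variable K : numFieldType.
Implicit Types x y : K.

Lemma numfield_archimedean (R : realType) :
  K = R :> numFieldType \/ K = R[i] :> numFieldType ->
  forall x, 0 <= x -> exists n : nat, x < n%:R.
Proof.
case=> -> x x0.
  by exists (Num.bound x); apply: archi_boundP.
exists (Num.bound (complex.Re x)).
case: x x0 => a b; rewrite lecE /= => /andP[/eqP -> a0].
by rewrite ltcE /= !raddfMn /= mul0rn eqxx /= archi_boundP.
Qed.

Lemma not_ler_norm_lt d x : 0 < d -> ~ d <= `|x| -> `|x| < d.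
Proof.
by move=> /gtr0_real d0 /negP; rewrite -real_ltNge// normr_real.
Qed.

(* At the first index where [q i * v i] drops below delta, it is still
   nonnegative. *)
Lemma first_small (q v : nat -> K) delta : 0 < delta ->
  (forall i, 0 < q i) -> 0 <= v 0%N ->
  (forall i, v i.+1 = v i - delta / q i) ->
  (exists i, q i * v i < delta) -> exists i, `|q i * v i| < delta.
Proof.
move=> d0 q0 v0 vS ex; exists (ex_minn ex).
case: ex_minnP => i qi mini; rewrite ger0_norm// mulr_ge0 ?(ltW (q0 _))//.
case: i qi mini => // i _ mini.
have vreal n : v n \is Num.real.
  elim: n => [|n IHn]; first exact: ger0_real.
  by rewrite vS rpredB// gtr0_real// divr_gt0.
have : ~~ (q i * v i < delta) by apply/negP => /mini; rewrite ltnn.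
rewrite -real_leNgt ?(gtr0_real d0)//; last first.
  by rewrite rpredM ?vreal// gtr0_real.
by rewrite vS subr_ge0 ler_pdivrMr// mulrC.
Qed.

(* [S n.+1 - S n = (h n)^-1 >= S n / C], so S, and with it [h^-1], grows at
   least linearly from any starting point, uniformly. *)
Lemma sum_bound_decay (h S : nat -> K) C : 0 < C -> (forall n, 0 < h n) ->
  S 0%N = 0 -> (forall n, S n.+1 = S n + (h n)^-1) ->
  (forall n, h n * S n <= C) ->
  forall n k, k%:R * h (n + k.+1)%N <= C ^+ 2 * h n.
Proof.
move=> C0 h0 S0 SS hC n k.
have Sge0 i : 0 <= S i.
  by elim: i => [|i IHi]; rewrite ?S0// SS addr_ge0// invr_ge0 ltW.
have grow : (C + k%:R) <= C * h n * S (n + k.+1)%N.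
  elim: k => [|k IHk].
    rewrite addr0 addn1 SS -mulrA ler_pMr// mulrDr divff ?gt_eqF// lerDr.
    by rewrite mulr_ge0// ltW.
  rewrite [(n + k.+2)%N]addnS SS mulrDr -natr1 addrA lerD//.
  have hS : S (n + k.+1)%N <= C / h (n + k.+1)%N.
    by rewrite ler_pdivlMr// mulrC.
  have S1 : (h n)^-1 <= S (n + k.+1)%N.
    elim: (k) => [|j /le_trans]; first by rewrite addn1 SS lerDr.
    by apply; rewrite [(n + j.+2)%N]addnS SS lerDl invr_ge0 ltW.
  have := ler_wpM2l (ltW (h0 n)) (le_trans S1 hS).
  by rewrite divff ?gt_eqF// mulrA (mulrC C).
have hk := h0 (n + k.+1)%N.
have := ler_wpM2r (ltW hk) grow; rewrite -[C * h n * _ * _]mulrA (mulrC (S _)).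
have Chn : 0 <= C * h n by rewrite mulr_ge0// ltW.
move=> /le_trans/(_ (ler_wpM2l Chn (hC _))).
rewrite expr2 mulrAC; apply: le_trans.
by rewrite ler_pM2r// lerDr ltW.
Qed.
End Order.

Section C0Facts.
Variable K : numFieldType.

Lemma c0_normr_lt (x : c0 K) M : (forall n, `|x n| < M) -> `|x| < M.
Proof. by have [m E _] := c0_normE x => /(_ m); rewrite -E. Qed.

Lemma c0_small (x : c0 K) e : 0 < e ->
  exists N : nat, forall n : int, (N <= `|n|)%N -> `|x n| < e.
Proof. exact/c0_seqP/(valP x). Qed.

Lemma c0_mulr (x : c0 K) (g : int -> K) (N : nat) (C : K) :
  (forall n : int, (N <= `|n|)%N -> `|g n| <= C) ->
  (fun n => x n * g n) \in @c0_seq K.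
Proof.
move=> gC; apply/c0_seqP => e e0.
have C0 : 0 < C + 1.
  by rewrite ltr_wpDl// (le_trans _ (gC N%:Z _))//.
have [|N' hN'] := c0_small x (e / (C + 1)); first by rewrite divr_gt0.
exists (maxn N N') => n; rewrite geq_max => /andP[/gC gn /hN' xn].
rewrite normrM; apply: le_lt_trans (_ : `|x n| * (C + 1) < e).
  by rewrite ler_wpM2l// (le_trans gn)// lerDl.
by rewrite -ltr_pdivlMr.
Qed.

Lemma periodic_vanish (x : int -> c0 K) : periodic_sequence x ->
  forall e, 0 < e -> exists N : nat, forall j n,
    (N <= `|n|)%N -> `|x j n| < e.
Proof.
move=> [p p0 xp] e e0.
suff [N hN] : exists N : nat, forall i : nat, (i < p)%N ->
    forall n : int, (N <= `|n|)%N -> `|x i n| < e.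
  exists N => j n Nn; rewrite (periodic_modz _ x p xp).
  have j0 : 0 <= (j %% p)%Z by rewrite modz_ge0//; lia.
  have jp : (j %% p)%Z < p by rewrite ltz_pmod.
  rewrite -(gez0_abs j0); apply: hN => //.
  by rewrite -ltz_nat gez0_abs.
elim: (p) => [|q [N hN]]; first by exists 0%N.
have [N' hN'] := c0_small (x q) e e0.
exists (maxn N N') => i; rewrite ltnS leq_eqVlt => /orP[/eqP ->|iq] n;
  rewrite geq_max => /andP[Nn N'n]; [exact: hN'|exact: hN].
Qed.

End C0Facts.

Section WeightedShift.
Variables (K : numFieldType) (w : int -> K) (w_bounded : bounded_fun w)
  (w_inf : 0 < infimum 0 [set `|w n| | n in setT]).
Let B := weighted_shift w_bounded w_inf.

Lemma weight_neq0 n : w n != 0.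
Proof.
rewrite -normr_gt0; move: w_inf; rewrite /infimum.
case: ifPn => [_|_]; first by rewrite ltxx.
case: xgetP => [c _ [lbc _] c0|_]; last by rewrite ltxx.
by apply: lt_le_trans c0 _; apply: lbc; exists n.
Qed.

Lemma shift_fixed_seq : exists u : int -> K,
  [/\ u 0 = 1, forall n, u n != 0 & forall n, u n = w (n + 1) * u (n + 1)].
Proof.
have [|u [u0 uS]] :=
  @int_recursion K 1 (fun n x => x / w (n + 1)) (fun n x => x * w (n + 1)).
  by move=> n x; rewrite mulfK// weight_neq0.
have {}uS n : u n = w (n + 1) * u (n + 1).
  by rewrite uS mulrC divfK// weight_neq0.
exists u; split=> //; elim/int_succ_ind => [|n]; first by rewrite u0 oner_neq0.
by rewrite uS mulf_eq0 negb_or weight_neq0.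
Qed.

(* [u] is the formal fixed point of B; multiplication by [u] turns the
   unweighted shift into B. *)
Variable u : int -> K.
Hypotheses (u0 : u 0 = 1) (u_neq0 : forall n, u n != 0)
  (uS : forall n, u n = w (n + 1) * u (n + 1)).

Let u_gt0 n : 0 < `|u n|. Proof. by rewrite normr_gt0. Qed.

Lemma shift_expE (j : int) (x : c0 K) n :
  op_exp B j x n = u n * (x (n + j) / u (n + j)).
Proof.
elim/int_rect: j n => [|j IHj|j IHj] n.
- by rewrite addr0 mulrC divfK.
- rewrite [LHS](_ : _ = w (n + 1) * op_exp B j x (n + 1))//.
  by rewrite IHj mulrA -uS -addrA -PoszD add1n.
have -> : op_exp B (- j.+1%:Z) x = op_inv B (op_exp B (- j%:Z) x).
  by case: j {IHj}.
rewrite [LHS](_ : _ = (w n)^-1 * op_exp B (- j%:Z) x (n - 1))//.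
rewrite IHj [u (n - 1)]uS subrK -mulrA mulKf ?weight_neq0//.
by rewrite (_ : n - 1 - j%:Z = n - j.+1%:Z)//; lia.
Qed.

Lemma pseudotrajectory_const delta (x : c0 K) :
  (forall n, `|w (n + 1) * x (n + 1) - x n| < delta) ->
  pseudotrajectory B delta (fun _ => x).
Proof. by move=> xd j; apply: c0_normr_lt. Qed.

Lemma pseudotrajectory_diag delta (x : int -> c0 K) :
  pseudotrajectory B delta x -> forall s n,
  `|w (n + 1) * x (s - (n + 1)) (n + 1) - x (s - n) n| < delta.
Proof.
move=> xd s n; apply: le_lt_trans (xd (s - (n + 1))).
apply: le_trans (le_c0_norm _ n).
by rewrite (_ : s - (n + 1) + 1 = s - n)//; lia.
Qed.

Lemma fixed_seq_c0 (x : c0 K) : x != 0 -> periodic_point B x ->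
  u \in @c0_seq K.
Proof.
move=> xn0 [p p0 xp].
have [r xr] : exists r, x r != 0.
  apply: contrapT => x0; case/eqP: xn0; apply: c0_ext => n.
  by apply/eqP/negPn/negP => xn; apply: x0; exists n.
have per : periodic_sequence (fun j => op_exp B j x).
  exists p => // j; apply: c0_ext => n; rewrite !shift_expE.
  have := shift_expE p x (n + j); rewrite [op_exp B p x]xp => ->.
  by rewrite [u (n + j) * _]mulrC mulfK// addrA.
apply/c0_seqP => e e0.
have f0 : 0 < `|x r / u r| by rewrite normr_gt0 mulf_neq0// invr_neq0.
have [|N hN] := periodic_vanish _ _ per (e * `|x r / u r|).
  by rewrite mulr_gt0.
exists N => n /(hN (r - n)); rewrite shift_expE normrM.
by rewrite [n + _]addrC subrK ltr_pM2r.
Qed.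

Section Shadowing.
Hypothesis u_c0 : u \in @c0_seq K.
Let uc : c0 K := C0 u_c0.

Let u_le n : `|u n| <= `|uc|. Proof. exact: (le_c0_norm uc). Qed.

(* Truncating [g] outside a finite window makes [u * g] an element of c0 that is
   almost fixed by B; its shadow is compared with it at the times [-n], where
   the line [j + n = 0] is seen. *)
Lemma drift_bound : periodic_shadowing_property B ->
  forall eps : K, 0 < eps -> exists2 delta : K, 0 < delta &
    forall g : int -> K, (forall n, `|u n| * `|g (n + 1) - g n| < delta) ->
    forall n, `|u n| * `|g n - g 0| < eps.
Proof.
move=> psp eps eps0.
have M0 : 0 < 1 + `|uc| by rewrite ltr_wpDr.
have [|delta d0 hd] := psp (eps / (1 + `|uc|)); first by rewrite divr_gt0.
exists delta => // g gd n.
pose N : int := `|n|%N.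
pose clamp (m : int) := if m < - N then - N else if N < m then N else m.
have gN m : (`|n| <= `|m|)%N ->
    `|g (clamp m)| <= `|g (- N)| + `|g N|.
  move=> nm; rewrite /clamp; case: ltP => m1; first by rewrite lerDl.
  case: ltP => m2; first by rewrite lerDr.
  have [->|->] : m = - N \/ m = N by rewrite /N in m1 m2 *; lia.
    by rewrite lerDl.
  by rewrite lerDr.
pose x : c0 K := C0 (c0_mulr _ uc (g \o clamp) _ _ gN).
have xE m : x m = u m * g (clamp m) by [].
have [||y _ hy] := hd (fun _ => x).
- apply: pseudotrajectory_const => m; rewrite !xE mulrA -uS -mulrBr normrM.
  have [->|[-> ->]] : clamp (m + 1) = clamp m \/
      clamp (m + 1) = m + 1 /\ clamp m = m.
  + by rewrite /clamp /N; do ?[case: ltP => ?]; lia.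
  + by rewrite subrr normr0 mulr0.
  + exact: gd.
- by exists 1%N.
have close m : `|u m| * `|g (clamp m) - y 0 / u 0| < eps / (1 + `|uc|).
  apply: le_lt_trans (hy (- m)); apply: le_trans (le_c0_norm _ m).
  rewrite [X in _ <= `|X|](_ : _ = x m - op_exp B (- m) y m)//.
  by rewrite shift_expE xE subrr -mulrBr normrM.
have cn : clamp n = n by rewrite /clamp /N; do ?[case: ltP => ?]; lia.
have c0 : clamp 0 = 0 by rewrite /clamp /N; do ?[case: ltP => ?]; lia.
have := close 0; rewrite c0 [in `|u 0|]u0 normr1 mul1r distrC => close0.
apply: le_lt_trans (_ : `|u n| * (`|g n - y 0 / u 0| + `|y 0 / u 0 - g 0|) < _).
  by rewrite ler_wpM2l// ler_distD.
rewrite -[eps](divfK (lt0r_neq0 M0)) mulrDr [X in _ < X]mulrDr mulr1 ltr_leD//.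
  by have := close n; rewrite cn.
by rewrite mulrC ler_pM// ltW.
Qed.

Lemma fixed_seq_decay : periodic_shadowing_property B ->
  exists2 C : K, 0 < C & forall n k : nat,
    k%:R * `|u (n%:Z + k.+1%:Z)| <= C * `|u n| /\
    k%:R * `|u (- (n%:Z + k.+1%:Z))| <= C * `|u (- n%:Z)|.
Proof.
move=> psp; have [delta d0 hd] := drift_bound psp 1 ltr01.
have [H HS] := int_primitive _ (fun n => `|u n|^-1).
have Hreal n : H n - H 0 \is Num.real.
  have ru m : `|u m|^-1 \is Num.real by rewrite realV normr_real.
  elim/int_succ_ind: n => [|n]; first by rewrite subrr rpred0.
  rewrite HS addrAC; split=> [h|/rpredB/(_ (ru n))]; first by rewrite rpredD.
  by rewrite addrK.
pose C := (delta / 2)^-1.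
have d20 : 0 < delta / 2 by rewrite divr_gt0.
have C0 : 0 < C by rewrite invr_gt0.
have hC n : `|u n| * `|H n - H 0| <= C.
  have := hd (fun n => delta / 2 * H n) _ n; rewrite -mulrBr normrM mulrCA.
  rewrite (gtr0_norm d20) => /(_ _)/ltW h.
  rewrite -[C]mul1r ler_pdivlMr// mulrC h// => m.
    rewrite HS -mulrBr addrAC subrr add0r normrM mulrCA.
    rewrite (gtr0_norm d20) normfV normr_id divff ?normr_eq0// mulr1.
    by rewrite ltr_pdivrMr// ltr_pMr// ltr1n.
pose D := C + `|uc|.
have D0 : 0 < D by rewrite ltr_wpDr.
exists (D ^+ 2) => [|n k]; first by rewrite exprn_gt0.
split.
- apply: (@sum_bound_decay K (fun n : nat => `|u n|) (fun n => H n%:Z - H 0)).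
  + by [].
  + by move=> i.
  + by rewrite subrr.
  + by move=> i; rewrite -addn1 PoszD HS addrAC.
  + move=> i; apply: le_trans (_ : C <= D); last by rewrite lerDl.
    apply: le_trans (hC i); rewrite ler_wpM2l//.
    exact: real_ler_norm.
- apply: (@sum_bound_decay K (fun n : nat => `|u (- n%:Z)|)
            (fun n => H 1 - H (1 - n%:Z))).
  + by [].
  + by move=> i.
  + by rewrite subr0 subrr.
  + move=> i; rewrite (_ : 1 - i%:Z = - i%:Z + 1); last by lia.
    by rewrite (_ : 1 - i.+1%:Z = - i%:Z) ?HS; [ring|lia].
  + move=> i.
    have H1 : H 1 = H 0 + 1 by rewrite -[1]add0r HS u0 normr1 invr1.
    rewrite (_ : 1 - i%:Z = - i%:Z + 1); last by lia.
    rewrite HS H1.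
    apply: le_trans (_ : `|u (- i%:Z)| * (`|H (- i%:Z) - H 0| + 1) <= _).
      rewrite ler_wpM2l// distrC.
      rewrite opprD addrA [H 0 + 1 - _]addrAC.
      rewrite lerBlDr -[leLHS]addr0 lerD ?invr_ge0// lerD2r.
      by rewrite -normrN opprB distrC real_ler_norm// -rpredN opprB.
    by rewrite mulrDr mulr1 lerD.
Qed.

Lemma shift_exp_mulu (y : c0 K) (c : int -> K) :
  (forall n, y n = u n * c n) ->
  forall j n, op_exp B j y n = u n * c (n + j).
Proof.
by move=> yE j n; rewrite shift_expE yE [u (n + j) * _]mulrC mulfK.
Qed.

Lemma shadowing_periodic_shadowing :
  shadowing_property B -> periodic_shadowing_property B.
Proof.
move=> sh eps eps0; have [delta d0 hd] := sh eps eps0.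
exists delta => // x xd [p p0 xp]; have [y hy] := hd x xd.
pose c (s : int) := y (s %% p)%Z / u (s %% p)%Z.
have cp s : c (s + p%:Z) = c s by rewrite /c modzDr.
have p_neq0 : p%:Z != 0 by lia.
have cC n : (0 <= `|n|)%N ->
    `|c n| <= \sum_(i < p) `|y i%:Z / u i%:Z|.
  move=> _; have m0 := modz_ge0 n p_neq0.
  have mp : (`|(n %% p)%Z| < p)%N by rewrite -ltz_nat gez0_abs// ltz_pmod.
  rewrite (bigD1 (Ordinal mp))//= gez0_abs// lerDl.
  by apply: sumr_ge0.
pose z : c0 K := C0 (c0_mulr _ uc c _ _ cC).
have zE n : z n = u n * c n by [].
exists z.
  exists p => //; apply: c0_ext => n.
  by rewrite -[iter _ _ _]/(op_exp B p z) (shift_exp_mulu _ _ zE) cp zE.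
move=> j; apply: c0_normr_lt => n.
rewrite [X in `|X|](_ : _ = x j n - op_exp B j z n)//.
rewrite (shift_exp_mulu _ _ zE) /c.
set s := ((n + j) %% p)%Z.
have -> : x j = x (s - n).
  rewrite (periodic_modz _ _ _ xp j) (periodic_modz _ _ _ xp (s - n)).
  by rewrite modzDml addrAC subrr add0r.
apply: le_lt_trans (hy (s - n)); apply: le_trans (le_c0_norm _ n).
rewrite [X in _ <= `|X|](_ : _ = x (s - n) n - op_exp B (s - n) y n)//.
by rewrite shift_expE (_ : n + (s - n) = s)// addrC subrK.
Qed.

Lemma periodic_shadowing_shadowing :
  (forall x : K, 0 <= x -> exists n : nat, x < n%:R) ->
  periodic_shadowing_property B -> shadowing_property B.
Proof.
move=> arch psp eps eps0.
have [C Cgt0 decay] := fixed_seq_decay psp.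
have [delta d0 hd] := drift_bound psp eps eps0.
exists delta => // x xd.
have close s n : `|x (s - n) n - u n * x s 0| < eps.
  have := hd (fun m => x (s - m) m / u m) _ n; rewrite subr0 u0 divr1.
  rewrite -normrM mulrBr mulrCA divff// mulr1; apply=> m.
  rewrite -normrM [X in `|X|](_ : _ =
    w (m + 1) * x (s - (m + 1)) (m + 1) - x (s - m) m).
    exact: (pseudotrajectory_diag _ _ xd).
  have uw : u m / u (m + 1) = w (m + 1) by rewrite [u m]uS mulfK.
  by rewrite mulrBr mulrCA uw [u m * _]mulrCA divff// mulr1 [w _ * _]mulrC.
have small (sg : bool) e : 0 < e -> exists N : nat,
    forall n : nat, (N <= n)%N ->
    `|u ((-1) ^+ sg * n%:Z) * x ((-1) ^+ sg * n%:Z) 0| < e.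
  move=> e0.
  have L0 : 0 <= C * (1 + eps) / e.
    by rewrite !mulr_ge0 ?invr_ge0 ?addr_ge0// ltW.
  have [k hk] := arch _ L0; have k0 := le_lt_trans L0 hk.
  pose t : int := (-1) ^+ sg * k.+1%:Z.
  have [N hN] := c0_small _ (x t) 1 ltr01.
  exists (N + k.+1)%N => n Nn.
  have [m -> Nm] : exists2 m, n = (m + k.+1)%N & (N <= m)%N.
    have kn : (k.+1 <= n)%N by rewrite (leq_trans _ Nn)// leq_addl.
    exists (n - k.+1)%N; first by rewrite subnK.
    by rewrite -(leq_add2r k.+1) subnK.
  set s := (-1) ^+ sg * (m + k.+1)%N%:Z; pose r : int := (-1) ^+ sg * m%:Z.
  have sr : s - r = t by rewrite /s /r -mulrBr PoszD addrAC subrr add0r.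
  have xr : `|x t r| < 1 by apply: hN; rewrite /r abszMsign.
  have dec : k%:R * `|u s| <= C * `|u r|.
    have [] := decay m k; rewrite -PoszD /s /r.
    by case: (sg); rewrite ?expr1 ?expr0 ?mulN1r ?mul1r.
  have ur : `|u r * x s 0| < 1 + eps.
    have := close s r; rewrite sr => h.
    rewrite -[u r * _](subKr (x t r)); apply: le_lt_trans (ler_normB _ _) _.
    exact: ltrD.
  rewrite normrM -(ltr_pM2l k0) mulrA.
  apply: le_lt_trans (ler_wpM2r (normr_ge0 _) dec) _.
  rewrite -mulrA -normrM; apply: lt_trans (_ : C * (1 + eps) < _).
    by rewrite ltr_pM2l.
  by rewrite -ltr_pdivrMr.
have y_c0 : (fun n => u n * x n 0) \in @c0_seq K.
  apply/c0_seqP => e e0.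
  have [N1 h1] := small false e e0; have [N2 h2] := small true e e0.
  exists (maxn N1 N2) => n; rewrite geq_max => /andP[/h1 + /h2].
  rewrite expr0 expr1 mul1r mulN1r.
  case: (leP 0 n) => [n0|/ltW n0]; first by rewrite gez0_abs.
  by rewrite lez0_abs// opprK.
exists (C0 y_c0) => j; apply: c0_normr_lt => n.
rewrite [X in `|X|](_ : _ = x j n - op_exp B j (C0 y_c0) n)//.
rewrite (shift_exp_mulu _ (fun n => x n 0))//.
by have := close (n + j) n; rewrite [n + j - n]addrAC subrr add0r.
Qed.

End Shadowing.

Section NoPeriodicPoint.

(* [delta * (H b - H a)] is the largest change that a line sequence can undergo
   between the indices a and b. *)
Variable H : int -> K.
Hypothesis HS : forall n, H (n + 1) = H n + `|u n|^-1.

Lemma wprodE (a : int) (d : nat) :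
  wprod (fun n => `|w n|) (a + 1) (a + d%:Z) = `|u a| / `|u (a + d%:Z)|.
Proof.
rewrite /wprod (_ : `|_|%N = d); last by lia.
elim: d => [|d IHd].
  by rewrite big_geq// addr0 divff// normr_eq0.
rewrite big_nat_recr//= IHd -addrA -PoszD add1n.
have -> : `|u (a + d%:Z)| = `|w (a + d.+1%:Z)| * `|u (a + d.+1%:Z)|.
  by rewrite -normrM uS -addrA -PoszD addn1.
by field; rewrite !normr_eq0 u_neq0 weight_neq0.
Qed.

Lemma primitive_sum (a : int) (d : nat) :
  \sum_(0 <= i < d) `|u (a + i%:Z)|^-1 = H (a + d%:Z) - H a.
Proof.
elim: d => [|d IHd]; first by rewrite big_geq// addr0 subrr.
by rewrite big_nat_recr//= IHd -addn1 PoszD addrA HS addrAC.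
Qed.

Lemma condition_aE eps delta (l m : int) : l <= m ->
  condition_a (fun n => `|w n|) eps delta l m =
  (delta <= `| `|u m| * (eps / `|u l| - delta * (H m - H l)) |).
Proof.
move=> lm; have [d ->] : exists d : nat, m = l + d%:Z.
  by exists `|m - l|%N; lia.
rewrite /condition_a wprodE invfM invrK (_ : `|_|%N = d); last by lia.
rewrite big_nat_rev/= -primitive_sum mulrBr mulrCA [`|u _| * (delta * _)]mulrCA.
congr (delta <= `|_ - delta * _|).
  by rewrite mulrCA mulrA mulrC mulrA.
rewrite mulr_sumr; apply: eq_big_nat => i /andP[_ id].
rewrite (_ : l + d%:Z - (0 + d - i.+1)%N%:Z = (l + i%:Z) + 1); last by lia.
rewrite (_ : l + d%:Z = (l + i%:Z) + (d - i)%N%:Z); last by lia.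
by rewrite wprodE invfM invrK mulrC.
Qed.

Lemma condition_bE eps delta (k l : int) : k <= l ->
  condition_b (fun n => `|w n|) eps delta k l =
  (delta <= `| `|u (k - 1)| * (eps / `|u l| - delta * (H l - H k)) |).
Proof.
move=> kl; have [d ->] : exists d : nat, l = k + d%:Z.
  by exists `|l - k|%N; lia.
have wE i : wprod (fun n => `|w n|) k (k + i%:Z) =
    `|u (k - 1)| / `|u (k + i%:Z)|.
  have := wprodE (k - 1) i.+1; rewrite subrK.
  by rewrite (_ : k - 1 + i.+1%:Z = k + i%:Z)//; lia.
rewrite /condition_b wE (_ : `|_|%N = d); last by lia.
rewrite -primitive_sum mulrBr [`|u _| * (delta * _)]mulrCA.
congr (delta <= `|_ - delta * _|); first by rewrite mulrAC mulrA.
by rewrite mulr_sumr; apply: eq_big_nat => i _; rewrite wE.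
Qed.

Lemma weight_condition_periodic_shadowing :
  weight_condition (fun n => `|w n|) -> periodic_shadowing_property B.
Proof.
move=> wc eps eps0; have [delta d0 hd] := wc eps eps0.
exists delta => // x xd xper; exists 0.
  by exists 1%N; rewrite //= linear0.
move=> j; rewrite (_ : op_exp B j 0 = 0) ?subr0; last first.
  by apply: c0_ext => n; rewrite shift_expE mul0r mulr0.
apply: c0_normr_lt => l; apply: not_ler_norm_lt => // xl.
pose s := j + l; pose f n := `|x (s - n) n| / `|u n|.
have uf n : `|u n| * f n = `|x (s - n) n| by rewrite /f mulrC divfK// normr_eq0.
have fl : eps / `|u l| <= f l.
  have sl : s - l = j by rewrite /s; lia.
  by rewrite /f sl ler_pM2r ?invr_gt0// normr_gt0.
have fdist n : `|f (n + 1) - f n| <= delta / `|u n|.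
  rewrite ler_pdivlMr// -[`|u n|]normr_id -normrM mulrC mulrBr (uf n).
  rewrite [u n]uS normrM -mulrA (uf (n + 1)) -normrM.
  apply: le_trans (ler_dist_dist _ _) _.
  exact/ltW/(pseudotrajectory_diag _ _ xd).
have freal n : f (n + 1) - f n \is Num.real.
  by rewrite rpredB// ger0_real// divr_ge0.
have fright (i : nat) :
    eps / `|u l| - delta * (H (l + i%:Z) - H l) <= f (l + i%:Z).
  elim: i => [|i IHi]; first by rewrite addr0 subrr mulr0 subr0.
  have := fdist (l + i%:Z); rewrite real_ler_distl// => /andP[+ _].
  rewrite -addrA -PoszD addn1; apply: le_trans.
  rewrite -[in H (l + i.+1%:Z)]addn1 PoszD addrA HS.
  by rewrite addrAC mulrDr opprD addrA lerD2r.
have fleft (i : nat) :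
    eps / `|u l| - delta * (H l - H (l - i%:Z)) <= f (l - i%:Z).
  elim: i => [|i IHi]; first by rewrite subr0 subrr mulr0 subr0.
  have nE : l - i.+1%:Z + 1 = l - i%:Z by lia.
  have := fdist (l - i.+1%:Z); rewrite real_ler_distl// => /andP[_].
  rewrite nE -lerBlDr; apply: le_trans.
  apply: le_trans (lerB IHi (lexx _)).
  by rewrite -nE HS le_eqVlt; apply/orP; left; apply/eqP; ring.
have [i hi] : exists i : nat,
    `| `|u (l + i%:Z)| * (eps / `|u l| - delta * (H (l + i%:Z) - H l)) |
    < delta.
  apply: (@first_small K (fun i : nat => `|u (l + i%:Z)|)
    (fun i : nat => eps / `|u l| - delta * (H (l + i%:Z) - H l))) => //.
  - by rewrite addr0 subrr mulr0 subr0 divr_ge0// ltW.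
  - by move=> i; rewrite -addn1 PoszD addrA HS addrAC mulrDr opprD addrA.
  - have [N hN] := periodic_vanish _ _ xper delta d0.
    exists (N + `|l|)%N; apply: le_lt_trans (ler_wpM2l _ (fright _)) _ => //.
    by rewrite uf; apply: hN; lia.
have [i' hi'] : exists i : nat,
    `| `|u (l - i%:Z - 1)| * (eps / `|u l| - delta * (H l - H (l - i%:Z))) |
    < delta.
  apply: (@first_small K (fun i : nat => `|u (l - i%:Z - 1)|)
    (fun i : nat => eps / `|u l| - delta * (H l - H (l - i%:Z)))) => //.
  - by rewrite subr0 subrr mulr0 subr0 divr_ge0// ltW.
  - move=> a; rewrite (_ : l - a.+1%:Z = l - a%:Z - 1); last by lia.
    have -> : H (l - a%:Z) = H (l - a%:Z - 1) + `|u (l - a%:Z - 1)|^-1.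
      by rewrite -HS subrK.
    ring.
  - have Bper : periodic_sequence (fun j => B (x j)).
      by case: xper => p p0 xp; exists p => // a; rewrite xp.
    have [N hN] := periodic_vanish _ _ Bper delta d0.
    exists (N + `|l|)%N; apply: le_lt_trans (ler_wpM2l _ (fleft _)) _ => //.
    set k := l - _; rewrite [u (k - 1)]uS subrK normrM -mulrA uf -normrM.
    have := hN (s - k) (k - 1); rewrite [B _ _]weighted_shiftE subrK; apply.
    by rewrite /k; lia.
have kl : l - i'%:Z <= l by lia.
have lm : l <= l + i%:Z by lia.
case: (hd _ _ _ kl lm).
  by rewrite condition_aE// => /le_lt_trans/(_ hi); rewrite ltxx.
by rewrite condition_bE// => /le_lt_trans/(_ hi'); rewrite ltxx.
Qed.

Lemma periodic_shadowing_weight_condition :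
  ~ (exists2 x : c0 K, x != 0 & periodic_point B x) ->
  periodic_shadowing_property B -> weight_condition (fun n => `|w n|).
Proof.
move=> noper psp eps eps0; have [delta0 d0 hd] := psp eps eps0.
pose delta := delta0 / 2; have del0 : 0 < delta by rewrite divr_gt0.
have dd : delta < delta0 by rewrite ltr_pdivrMr// ltr_pMr// ltr1n.
exists delta => // k l m kl lm; apply: contrapT => /not_orP[].
have nid (a b : K) : `| `|a| * b| = `|a * b| by rewrite !normrM normr_id.
rewrite condition_aE// condition_bE// !nid => /(not_ler_norm_lt _ _ _ del0) ha.
move=> /(not_ler_norm_lt _ _ _ del0) hb.
pose g n := if (k <= n) && (n <= m) then
  eps / `|u l| - delta * (if l <= n then H n - H l else H l - H n) else 0.
have g0 n : (n < k) || (m < n) -> g n = 0.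
  by rewrite /g => nkm; rewrite ifF//; lia.
have x_c0 : (fun n => u n * g n) \in @c0_seq K.
  apply/c0_seqP => e e0; exists (`|k| + `|m|).+1 => n nkm.
  by rewrite g0 ?mulr0 ?normr0//; lia.
have [||y yper hy] := hd (fun _ => C0 x_c0); last 1 first.
- have y0 : y = 0.
    by apply: contrapT => /eqP yn0; apply: noper; exists y.
  have : `|u l * g l| < eps.
    apply: le_lt_trans (hy 0); rewrite [op_exp B 0 y]y0 subr0.
    exact: (le_c0_norm (C0 x_c0) l).
  rewrite /g kl lm lexx subrr mulr0 subr0 normrM.
  rewrite [`|_ / _|]gtr0_norm ?divr_gt0//.
  by rewrite mulrC divfK ?normr_eq0// ltxx.
- apply: pseudotrajectory_const => n.
  rewrite [X in `|X|](_ : _ =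
    w (n + 1) * (u (n + 1) * g (n + 1)) - u n * g n)//.
  rewrite mulrA -uS -mulrBr.
  have [nk|nk] := ltP n k.
    rewrite (g0 n) ?nk// subr0.
    have [nk1|nk1] := ltP (n + 1) k; first by rewrite g0 ?nk1// mulr0 normr0.
    have -> : n = k - 1 by lia.
    rewrite subrK; apply: lt_trans dd; rewrite /g lexx (le_trans kl lm) /=.
    case: ifP => // lk; have lk' : l = k by lia.
    by move: hb; rewrite lk' subrr.
  have [mn|mn] := ltP m (n + 1).
    rewrite (g0 (n + 1)) ?mn ?orbT// sub0r.
    have [mn1|mn1] := ltP m n.
      by rewrite g0 ?mn1 ?orbT// oppr0 mulr0 normr0.
    have -> : n = m by lia.
    apply: lt_trans dd; rewrite /g lexx (le_trans kl lm) lm /=.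
    by rewrite mulrN normrN.
  apply: le_lt_trans dd; rewrite normrM.
  have -> : `|g (n + 1) - g n| = delta / `|u n|.
    have -> : delta / `|u n| = `|delta / `|u n| |.
      by rewrite [RHS]gtr0_norm// divr_gt0.
    have k1 : k <= n + 1 by lia.
    have mn0 : n <= m by lia.
    rewrite /g nk k1 mn mn0 /=.
    have [ln|nl] := leP l n.
      rewrite ifT; last by apply: le_trans ln _; rewrite lerDl.
      rewrite HS -normrN; congr `|_|; ring.
    have [ln1|nl1] := leP l (n + 1).
      have -> : l = n + 1 by lia.
      rewrite HS; congr `|_|; ring.
    rewrite HS; congr `|_|; ring.
  by rewrite mulrC divfK// normr_eq0.
- by exists 1%N.
Qed.

End NoPeriodicPoint.

End WeightedShift.

Theorem theorem4p12 (R : realType) (K : numFieldType)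
    (K_real_or_complex : K = R :> numFieldType \/ K = R[i] :> numFieldType)
    (w : int -> K) (w_bounded : bounded_fun w)
    (w_inf : 0 < infimum 0 [set `|w n| | n in setT]) :
  let B := weighted_shift w_bounded w_inf in
  ((exists2 x : c0 K, x != 0 & periodic_point B x) ->
     (periodic_shadowing_property B <-> shadowing_property B)) /\
  (~ (exists2 x : c0 K, x != 0 & periodic_point B x) ->
     (periodic_shadowing_property B <->
      weight_condition (fun n => `|w n|))).
Proof.
move=> B.
have [u [u0 u_neq0 uS]] := shift_fixed_seq K w w_inf.
have [H HS] := int_primitive _ (fun n => `|u n|^-1).
split=> [[x xn0 xper]|noper]; split.
- apply: (periodic_shadowing_shadowing _ _ _ _ _ u0 u_neq0 uS).
    exact: fixed_seq_c0 xn0 xper.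
  exact: numfield_archimedean K_real_or_complex.
- apply: (shadowing_periodic_shadowing _ _ _ _ _ u_neq0 uS).
  exact: fixed_seq_c0 xn0 xper.
- exact: (periodic_shadowing_weight_condition _ _ _ _ _ u_neq0 uS H HS).
- exact: (weight_condition_periodic_shadowing _ _ _ _ _ u_neq0 uS H HS).
Qed.
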